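(* Let conditions (E) and (S1) hold. For $\delta>0$ and $\bar x,\bar p\in\mathbb{R}^n$, let $w_\delta=w_\delta(\cdot;\bar x,\bar p)\in C^2(\mathbb{R}^m)$ be the unique bounded solution of $$\delta w_\delta(y)-\mathrm{tr}(\tau(y)\tau(y)^TD^2w_\delta(y))-b(y)\cdot Dw_\delta(y)-|\sigma(\bar x,y)^T\bar p|^2=0\quad\text{in }\mathbb{R}^m.$$ Then for all $k\in\mathbb{N}$ and all $\bar x,\bar p\in\mathbb{R}^n$ there exists $C>0$ such that $$\max_{y\in\bar B_k}|D_yw_\delta(y;\bar x,\bar p)|\le C,$$ where $B_k$ is the ball of radius $k$ and center $0$ in $\mathbb{R}^m$ and $C$ depends on $k$ and on $\bar p$ (and in particular not on $\delta$).
   Context: Standing assumptions: $\sigma:\mathbb{R}^n\times\mathbb{R}^m\to \mathbf{M}^{n,m}$ (real $n\times m$ matrices) is bounded and Lipschitz continuous in $(x,y)$; $b:\mathbb{R}^m\to\mathbb{R}^m$ is Lipschitz continuous; $\tau:\mathbb{R}^m\to\mathbf{M}^{m,m}$ is bounded, Lipschitz continuous and uniformly non-degenerate: for some $\theta>0$, $|\tau(y)^T\xi|^2>\theta|\xi|^2$ for all $y\in\mathbb{R}^m$ and $\xi\in\mathbb{R}^m\setminus\{0\}$. These coefficients are fixed throughout. (E): there exist $B>0$ and $R$ such that $b(y)\cdot y\le -B|y|^2$ whenever $|y|>R$. (S1): for each $x\in\mathbb{R}^n$ there exists $\nu>0$ such that $|\sigma(x,y)^T\xi|^2\ge\nu|\xi|^2$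 for all $y\in\mathbb{R}^m$, $\xi\in\mathbb{R}^n$. *)

(* Defs.v *)
From mathcomp Require Import all_boot all_order all_algebra.
From mathcomp Require Import all_classical all_reals all_analysis.

Set Implicit Arguments.
Unset Strict Implicit.
Unset Printing Implicit Defensive.

Import Order.TTheory GRing.Theory Num.Theory.
Import numFieldNormedType.Exports.

Local Open Scope classical_set_scope.
Local Open Scope ring_scope.

(* The library norm `|v| on matrices is the sup norm, so the Euclidean inner
   product and norm are defined here.  The library norm is used only through
   [lipschitz], [bounded_fun] and [continuous], which do not depend on the
   choice of norm in finite dimension. *)
Definition dot (R : realType) (d : nat) (u v : 'cV[R]_d) : R :=
  \sum_(i < d) u i 0 * v i 0.

Definition enorm (R : realType) (d : nat) (v : 'cV[R]_d) : R :=
  Num.sqrt (dot v v).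

Definition partial (R : realType) (d : nat) (i : 'I_d) (w : 'cV[R]_d -> R)
  : 'cV[R]_d -> R := fun y => 'D_(delta_mx i 0) w y.

Definition grad (R : realType) (d : nat) (w : 'cV[R]_d -> R) (y : 'cV[R]_d)
  : 'cV[R]_d := \col_i partial i w y.

Definition hess (R : realType) (d : nat) (w : 'cV[R]_d -> R) (y : 'cV[R]_d)
  : 'M[R]_d := \matrix_(i, j) partial j (partial i w) y.

(* ['D_v] is a total operator, so the existence of the partial derivatives is
   required separately from their continuity. *)
Definition C1 (R : realType) (d : nat) (w : 'cV[R]_d -> R) : Prop :=
  continuous w /\
  forall i : 'I_d, (forall y, derivable w y (delta_mx i 0)) /\
                   continuous (partial i w).

Definition C2 (R : realType) (d : nat) (w : 'cV[R]_d -> R) : Prop :=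
  C1 w /\ forall i : 'I_d, C1 (partial i w).

Definition uniformly_nondegenerate (R : realType) (m : nat)
    (tau : 'cV[R]_m -> 'M[R]_m) : Prop :=
  exists2 theta : R, 0 < theta &
    forall y xi : 'cV[R]_m, xi != 0 ->
      theta * enorm xi ^+ 2 < enorm ((tau y)^T *m xi) ^+ 2.

Definition standing_assumptions (R : realType) (n m : nat)
    (sigma : 'cV[R]_n -> 'cV[R]_m -> 'M[R]_(n, m))
    (b : 'cV[R]_m -> 'cV[R]_m) (tau : 'cV[R]_m -> 'M[R]_m) : Prop :=
  [/\ bounded_fun (fun z : 'cV[R]_n * 'cV[R]_m => sigma z.1 z.2) /\
      lipschitz (fun z : 'cV[R]_n * 'cV[R]_m => sigma z.1 z.2),
      lipschitz b,
      bounded_fun tau /\ lipschitz tau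
    & uniformly_nondegenerate tau].

Definition condition_E (R : realType) (m : nat)
    (b : 'cV[R]_m -> 'cV[R]_m) : Prop :=
  exists B R0 : R, 0 < B /\
    forall y : 'cV[R]_m, R0 < enorm y -> dot (b y) y <= - B * enorm y ^+ 2.

Definition condition_S1 (R : realType) (n m : nat)
    (sigma : 'cV[R]_n -> 'cV[R]_m -> 'M[R]_(n, m)) : Prop :=
  forall x : 'cV[R]_n, exists2 nu : R, 0 < nu &
    forall (y : 'cV[R]_m) (xi : 'cV[R]_n),
      nu * enorm xi ^+ 2 <= enorm ((sigma x y)^T *m xi) ^+ 2.

Definition bounded_solution (R : realType) (n m : nat)
    (sigma : 'cV[R]_n -> 'cV[R]_m -> 'M[R]_(n, m))
    (b : 'cV[R]_m -> 'cV[R]_m) (tau : 'cV[R]_m -> 'M[R]_m)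
    (delta : R) (x p : 'cV[R]_n) (w : 'cV[R]_m -> R) : Prop :=
  [/\ C2 w, bounded_fun w &
      forall y : 'cV[R]_m,
        delta * w y - \tr (tau y *m (tau y)^T *m hess w y)
          - dot (b y) (grad w y) - enorm ((sigma x y)^T *m p) ^+ 2 = 0].

(* Main.v *)
Require Import Defs.
From mathcomp Require Import all_boot all_order all_algebra.
From mathcomp Require Import all_classical all_reals all_analysis.
From mathcomp Require Import ring lra.
Import Order.TTheory GRing.Theory Num.Theory.
Import numFieldNormedType.Exports.
Set Implicit Arguments.
Unset Strict Implicit.
Unset Printing Implicit Defensive.
Local Open Scope classical_set_scope.
Local Open Scope ring_scope.

(** Why the bound holds.  Variables are doubled: [w x - w y] is compared with a
barrier
[[
  Psi x y = M * (phi r + eta) * (K0 + |x|^2 + |y|^2),   r = |x - y|,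
]]
where [phi r = min (1 - exp (- N r)) (1 - exp (- N R1))] is increasing and
concave.  Let [M] bound the source term.  Suppose [w x - w y - Psi x y] has a
positive maximum.  Its value on the diagonal is negative, so [x != y] there.
For any matrices [U], [V] with [U U^T = tau tau^T (x)] and
[V V^T = tau tau^T (y)], moving [x] along the [k]-th column of [U] and [y] along
the [k]-th column of [V] gives a one-variable second-derivative test; moving
along [(b x, b y)] gives a first-derivative test.  Summing them
([barrier_generator]) shows that the generator of the coupled diffusion, applied
to [Psi], is at least the generator applied to [w x - w y], which by the equation
is [delta (w x - w y)] minus a difference of sources, hence larger than [- M].
The number [delta] enters only through the sign of [delta (w x - w y)], and this
is what makes the estimate uniform in [delta].  Only first and second derivatives
of [w] occur, so the argument works for [w] of class C2 and Lipschitz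
coefficients, where differentiating the equation is impossible.

It remains to choose [U], [V] and the constants so that the generator of [Psi] is
at most [- M] off the diagonal.
- When [r <= R1] the concavity of [phi] must produce the negative sign.  For
  this, [U - V] has to be large in the direction [x - y] and small, of order [r],
  in the orthogonal directions.  For small [r] this is achieved by reflecting the
  noise ([reflection_coupling]), and for other [r] by independent noises
  ([exists_coupling] joins the two).  The term in [phi''] carries a factor
  [N^2], so a large [N] absorbs the drift and the cross terms, and a large [K0]
  absorbs the growth of the weight ([generator_estimate]).
- When [r >= R1] the profile is constant and at least one of the two points is
  far from the origin, where the dissipativity of the drift makes the generator
  of the weight negative ([far_estimate]).

The number [eta > 0] makes the barrier positive on the diagonal and proper, so
that the maximum is attained; the final bound follows by letting [eta] tend to
0.  Since [phi r <= N r], this gives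
[w x - w y <= K |x - y| (K0 + |x|^2 + |y|^2)] ([two_point_bound]), from which the
partial derivatives are bounded on each ball. *)

(** * Euclidean and Frobenius products *)

Section Euclid.
Context {R : realType}.
Implicit Types m d : nat.

Lemma dotC m (u v : 'cV[R]_m) : dot u v = dot v u.
Proof. by apply: eq_bigr => i _; rewrite mulrC. Qed.

Lemma dotDl m (u v x : 'cV[R]_m) : dot (u + v) x = dot u x + dot v x.
Proof.
by rewrite /dot -big_split /=; apply: eq_bigr => i _; rewrite mxE mulrDl.
Qed.

Lemma dotZl m (a : R) (u x : 'cV[R]_m) : dot (a *: u) x = a * dot u x.
Proof.
by rewrite /dot mulr_sumr; apply: eq_bigr => i _; rewrite mxE mulrA.
Qed.

Lemma dotNl m (u x : 'cV[R]_m) : dot (- u) x = - dot u x.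
Proof. by rewrite -scaleN1r dotZl mulN1r. Qed.

Lemma dotDr m (u v x : 'cV[R]_m) : dot x (u + v) = dot x u + dot x v.
Proof. by rewrite dotC dotDl !(dotC x). Qed.

Lemma dotZr m (a : R) (u x : 'cV[R]_m) : dot x (a *: u) = a * dot x u.
Proof. by rewrite dotC dotZl dotC. Qed.

Lemma dotNr m (u x : 'cV[R]_m) : dot x (- u) = - dot x u.
Proof. by rewrite dotC dotNl dotC. Qed.

Lemma dot_ge0 m (u : 'cV[R]_m) : 0 <= dot u u.
Proof. by apply: sumr_ge0 => i _; rewrite -expr2 sqr_ge0. Qed.

Lemma dot_gt0 m (u : 'cV[R]_m) : u != 0 -> 0 < dot u u.
Proof.
move=> u0; rewrite lt_def dot_ge0 andbT; apply: contra u0 => /eqP u0.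
apply/eqP/matrixP => i j; rewrite ord1 mxE.
have /psumr_eq0P := u0; move/(_ (fun i _ => _)) => h.
have /(_ i isT)/eqP := h (fun i => ltac:(by rewrite -expr2 sqr_ge0)).
by rewrite -expr2 sqrf_eq0 => /eqP.
Qed.

Lemma enorm_sqr m (u : 'cV[R]_m) : enorm u ^+ 2 = dot u u.
Proof. by rewrite sqr_sqrtr// dot_ge0. Qed.

Lemma enorm_ge0 m (u : 'cV[R]_m) : 0 <= enorm u.
Proof. exact: sqrtr_ge0. Qed.

Lemma dot_sqr_le m (u v : 'cV[R]_m) : dot u v ^+ 2 <= dot u u * dot v v.
Proof.
have [->|v0] := eqVneq v 0.
  by rewrite -(scale0r 0) !dotZr !mul0r expr0n mulr0.
have := dot_ge0 (dot v v *: u - dot u v *: v).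
rewrite !(dotDl, dotDr, dotNl, dotNr, dotZl, dotZr) (dotC v u).
have v1 := dot_gt0 v0; set a := dot u u; set b := dot u v; set c := dot v v in v1 *.
move=> h; suff : 0 <= c * (a * c - b ^+ 2) by rewrite pmulr_rge0// subr_ge0.
by lra.
Qed.

Lemma dot_mulmxl m d (A : 'M[R]_(m, d)) (u : 'cV[R]_d) (v : 'cV[R]_m) :
  dot (A *m u) v = dot u (A^T *m v).
Proof.
have dotE k (x y : 'cV[R]_k) : dot x y = (x^T *m y) 0 0.
  by rewrite mxE; apply: eq_bigr => i _; rewrite mxE.
by rewrite !dotE trmx_mul mulmxA.
Qed.

Definition frob2 m d (A : 'M[R]_(m, d)) : R :=
  \sum_(k < d) dot (col k A) (col k A).

Lemma frob2_ge0 m d (A : 'M[R]_(m, d)) : 0 <= frob2 A.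
Proof. by apply: sumr_ge0 => k _; exact: dot_ge0. Qed.

Lemma dot_trmx_mul m d (A B : 'M[R]_(m, d)) (x y : 'cV[R]_m) :
  dot (A^T *m x) (B^T *m y) = \sum_(k < d) dot (col k A) x * dot (col k B) y.
Proof.
apply: eq_bigr => k _; congr (_ * _); rewrite mxE;
  by apply: eq_bigr => i _; rewrite !mxE.
Qed.

(** Second-order terms of the equation are traces, whereas the maximum principle
yields quadratic forms in the columns of a factor of the diffusion matrix; this
identity passes from one to the other. *)
Lemma mxtrace_gram m d (A : 'M[R]_(m, d)) (M : 'M[R]_m) :
  \tr (A *m A^T *m M) = \sum_(k < d) dot (col k A) (M *m col k A).
Proof.
rewrite -mulmxA mxtrace_mulC -mulmxA; apply: eq_bigr => k _.
rewrite mxE; apply: eq_bigr => i _; congr (_ * _); first by rewrite !mxE.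
by rewrite !mxE; apply: eq_bigr => j _; rewrite !mxE.
Qed.

Lemma frob2_gram m d (A : 'M[R]_(m, d)) : frob2 A = \tr (A *m A^T).
Proof.
by rewrite -[A *m A^T]mulmx1 mxtrace_gram; apply: eq_bigr => k _; rewrite mul1mx.
Qed.

Lemma dot_trmx_mul_le m d (A : 'M[R]_(m, d)) (x : 'cV[R]_m) :
  dot (A^T *m x) (A^T *m x) <= frob2 A * dot x x.
Proof.
rewrite dot_trmx_mul /frob2 mulr_suml; apply: ler_sum => k _.
by rewrite -expr2 dot_sqr_le.
Qed.

Lemma dotD_sqr_le m (u v : 'cV[R]_m) :
  dot (u + v) (u + v) <= 2 * (dot u u + dot v v).
Proof.
have := dot_ge0 (u - v).
by rewrite !(dotDl, dotDr, dotNl, dotNr) (dotC v u); lra.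
Qed.

Lemma dotB_scale_ge0 m (r : R) (u v : 'cV[R]_m) :
  0 <= dot u u + r ^+ 2 * dot v v - 2 * r * dot u v.
Proof.
have := dot_ge0 (u - r *: v).
by rewrite !(dotDl, dotDr, dotNl, dotNr, dotZl, dotZr) (dotC v u); lra.
Qed.

Lemma frob2B_le m d (A B : 'M[R]_(m, d)) :
  frob2 (A - B) <= 2 * (frob2 A + frob2 B).
Proof.
rewrite /frob2 -big_split mulr_sumr /=; apply: ler_sum => k _.
have := dotD_sqr_le (col k A) (- col k B).
by rewrite dotNl dotNr opprK -linearN -linearD.
Qed.

End Euclid.

(** * Directional derivatives and the second-derivative test *)

Lemma is_derive_cvgP (R : realType) (V : normedModType R) (f : V -> R) (a v : V)
    (d : R) :
  is_derive a v f d <->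
  ((fun h : R => h^-1 * (f (a + h *: v) - f a)) @ 0^' --> d)%classic.
Proof.
have e : (fun h : R => h^-1 * (f (a + h *: v) - f a)) =
    (fun h => h^-1 *: ((f \o shift a) (h *: v) - f a)).
  by apply/funext => h; rewrite /= [a + _]addrC.
rewrite e; split => [[d1 <-]|cv]; first exact: d1.
by split; [apply/cvg_ex; exists d|exact/cvg_lim].
Qed.

Lemma is_derive_line (R : realType) (V : normedModType R) (f : V -> R) (x u : V)
    (t d : R) :
  is_derive (x + t *: u) u f d -> is_derive t 1 (fun s : R => f (x + s *: u)) d.
Proof.
move=> /is_derive_cvgP h; apply/is_derive_cvgP.
apply: cvg_trans h; apply: near_eq_cvg; apply: nearW => h /=.
by rewrite scalerDl addrA -scalerA scale1r.
Qed.

Lemma mean_value_signed (R : realType) (g dg : R -> R) (h : R) :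
  (forall t : R, is_derive t 1 g (dg t)) ->
  exists2 c, `|c| <= `|h| & g h - g 0 = dg c * h.
Proof.
move=> dgE.
have cg (a b : R) : {within `[a, b]%classic, continuous g}.
  apply: continuous_subspaceT => t; apply: differentiable_continuous.
  by apply/derivable1_diffP; have [] := dgE t.
have [h0|h0|->] := ltgtP h 0.
- have [c] := MVT h0 (fun t _ => dgE t) (cg h 0).
  rewrite in_itv /= => /andP[hc c0] e; exists c.
    by rewrite !ltr0_norm// lerN2 ltW.
  by rewrite -opprB e sub0r mulrN opprK.
- have [c] := MVT h0 (fun t _ => dgE t) (cg 0 h).
  rewrite in_itv /= => /andP[c0 hc] e; exists c.
    by rewrite !gtr0_norm// ltW.
  by rewrite e subr0.
- by exists 0 => //; rewrite subrr mulr0.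
Qed.

(** The increment along [u + v] is the increment along [u] followed by an increment
along [v] from a nearby point.  The mean value theorem turns the second one into
a value of [dv] close to [y], so continuity of [dv] is needed for one of the two
directions only, and total differentiability for neither. *)
Lemma is_derive_dirD (R : realType) (V : normedModType R) (f dv : V -> R)
    (y u v : V) (du : R) :
  is_derive y u f du -> (forall z, is_derive z v f (dv z)) ->
  continuous dv -> is_derive y (u + v) f (du + dv y).
Proof.
move=> /is_derive_cvgP fu fv cdv; apply/is_derive_cvgP.
have fv2 : ((fun h : R => h^-1 * (f (y + h *: u + h *: v) - f (y + h *: u))) @ 0^'
    --> dv y)%classic.
  apply/cvgrPdist_lt => e e0.
  have /cvgrPdist_lt /(_ e e0) := cdv y.
  move=> /nbhs_ballP[r /= r0 yr].
  have K0 : 0 < r / (`|u| + `|v| + 1).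
    by rewrite divr_gt0// ltr_wpDl// addr_ge0.
  near=> h.
  have h0 : h != 0 by near: h; exact: nbhs_dnbhs_neq.
  have [c ch] := @mean_value_signed R (fun t => f (y + h *: u + t *: v))
    (fun t => dv (y + h *: u + t *: v)) h (fun t => is_derive_line (fv _)).
  rewrite scale0r addr0 => ->.
  rewrite mulrCA mulVf// mulr1; apply: yr.
  rewrite -ball_normE /= -addrA opprD addrA subrr sub0r normrN.
  have hr : `|h| * (`|u| + `|v| + 1) < r.
    rewrite -ltr_pdivlMr ?ltr_wpDl ?addr_ge0//.
    near: h; apply: dnbhs0_lt => //.
  apply: le_lt_trans hr; apply: (le_trans (ler_normD _ _)).
  rewrite !normrZ !mulrDr mulr1 -[leLHS]addr0.
  by rewrite lerD// lerD2l ler_wpM2r.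
suff -> : (fun h : R => h^-1 * (f (y + h *: (u + v)) - f y)) =
    (fun h => h^-1 * (f (y + h *: u) - f y)) +
    (fun h => h^-1 * (f (y + h *: u + h *: v) - f (y + h *: u))).
  exact: cvgD.
apply/funext => h.
rewrite /GRing.add_fun /= -mulrDr scalerDr addrA; congr (_ * _).
by rewrite [RHS]addrC addrA subrK.
Unshelve. all: by end_near. Qed.

Lemma is_derive_dirZ (R : realType) (V : normedModType R) (f : V -> R)
    (y v : V) (c d : R) :
  is_derive y v f d -> is_derive y (c *: v) f (c * d).
Proof.
move=> fv; have [->|c0] := eqVneq c 0.
  by rewrite scale0r mul0r; exact: is_derive0.
move/is_derive_cvgP : fv => fv; apply/is_derive_cvgP.
have cc : ((fun h : R => c * h) @ 0^' --> 0^')%classic.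
  move=> A /= [r /= r0 Ar]; exists (r / `|c|) => /=.
    by rewrite divr_gt0// normr_gt0.
  move=> h; rewrite /= !sub0r !normrN => hr h0; apply: Ar => /=.
    by rewrite sub0r normrN normrM mulrC -ltr_pdivlMr// normr_gt0.
  by rewrite mulf_neq0.
suff -> : (fun h : R => h^-1 * (f (y + h *: (c *: v)) - f y)) =
    (fun h => c * ((fun h => h^-1 * (f (y + h *: v) - f y)) \o *%R c) h).
  by apply: cvgM; [exact: cvg_cst|exact: cvg_comp cc fv].
apply/funext => h /=.
rewrite /GRing.mul_fun /= invfM mulrA mulrA mulfV// mul1r scalerA.
by rewrite [c * h]mulrC.
Qed.

Lemma col_sum_delta (R : realType) (m : nat) (u : 'cV[R]_m) :
  u = \sum_(i < m) u i 0 *: delta_mx i 0.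
Proof.
rewrite {1}[u]matrix_sum_delta; apply: eq_bigr => i _.
by rewrite big_ord1.
Qed.

(** Partial derivatives are given along the coordinate axes only; adding one
coordinate at a time reaches every direction. *)
Lemma C1_is_derive (R : realType) (m : nat) (w : 'cV[R]_m -> R) :
  C1 w -> forall y u, is_derive y u w (dot u (grad w y)).
Proof.
move=> [cw dw] y u; rewrite {1}[u]col_sum_delta /dot.
elim: (index_enum _) => [|i s ih]; first by rewrite !big_nil; exact: is_derive0.
have [di ci] := dw i.
have dv z : is_derive z (u i 0 *: delta_mx i 0) w (u i 0 * partial i w z).
  by apply: is_derive_dirZ; exact: derivableP (di z).
have cv : continuous (fun z => u i 0 * partial i w z).
  by move=> z; apply: continuousM; [exact: cst_continuous|exact: ci].
rewrite !big_cons [grad w y i 0]mxE.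
rewrite [_ *: _ + _]addrC [_ * _ + _]addrC.
exact: is_derive_dirD ih dv cv.
Qed.

(** If [h2] were positive, [h1] would be positive just to the right of 0 and [h]
would increase there. *)
Lemma second_order_max (R : realType) (h h1 : R -> R) (h2 : R) :
  (\forall t \near (0 : R), is_derive (t : R) 1 h (h1 t)) ->
  is_derive (0 : R) 1 h1 h2 -> (forall t, h t <= h 0) ->
  h1 0 = 0 /\ h2 <= 0.
Proof.
move=> /nbhs_ballP[r /= r0 hr] dh1 hmax.
have hr' (t : R) : - r < t < r -> is_derive t 1 h (h1 t).
  move=> tr; apply: hr; rewrite /ball /= sub0r normrN ltr_norml.
  by case/andP: tr => -> ->.
have h10 : h1 0 = 0.
  have dh0 : is_derive (0 : R) 1 h 0.
    apply: (@derive1_at_max _ h (- r) r) => //.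
    - by rewrite ge0_cp// ltW.
    - by move=> t; rewrite in_itv /= => /hr'[].
    - by rewrite in_itv /= oppr_lt0 r0.
  have [_ <-] := hr' 0 ltac:(by rewrite oppr_lt0 r0).
  by case: dh0.
split => //; rewrite leNgt; apply/negP => h20.
move/is_derive_cvgP : dh1 => /cvgrPdist_lt /(_ h2 h20).
move=> [e /= e0 he].
have pos (t : R) : 0 < t -> t < e -> 0 < h1 t.
  move=> t0 te.
  have := he t; rewrite /= sub0r normrN gtr0_norm// => /(_ te).
  move=> /(_ (lt0r_neq0 t0)); rewrite h10 subr0 add0r [t *: 1]mulr1.
  rewrite ltr_norml => /andP[_].
  rewrite ltrBlDr ltrDl pmulr_rgt0 ?invr_gt0//.
pose b := Num.min e r / 2.
have b0 : 0 < b by rewrite divr_gt0// lt_min e0 r0.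
have bm : b < Num.min e r by rewrite /b ltr_pdivrMr// mulr_natr mulr2n ltrDl lt_min e0 r0.
have [be br] : b < e /\ b < r by move: bm; rewrite lt_min => /andP[].
have db (t : R) : t \in `]0, b[%R -> is_derive t 1 h (h1 t).
  rewrite in_itv /= => /andP[t0 tb]; apply: hr'.
  by rewrite (lt_trans tb br) (lt_trans _ t0)// oppr_lt0.
have cb : {within `[0, b]%classic, continuous h}.
  apply: derivable_within_continuous => t; rewrite in_itv /= => /andP[t0 tb].
  suff /hr'[] : - r < t < r by [].
  by rewrite (le_lt_trans tb br) (lt_le_trans _ t0)// oppr_lt0.
have [c] := MVT b0 db cb.
rewrite in_itv /= => /andP[c0 cb'] e1.
have := hmax b; rewrite leNgt => /negP; apply.
by rewrite -subr_gt0 e1 subr0 mulr_gt0// pos// (lt_trans cb').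
Qed.

(** * Couplings of two diffusion matrices *)

Section Coupling.
Context {R : realType}.

Lemma coercive_unitmx m (T : 'M[R]_m) (theta : R) : 0 < theta ->
  (forall xi, theta * dot xi xi <= dot (T^T *m xi) (T^T *m xi)) -> T \in unitmx.
Proof.
move=> t0 hT; rewrite -row_free_unit -kermx_eq0.
apply/rowV0P => v /sub_kermxP vT.
have := hT v^T; rewrite -trmx_mul vT trmx0.
have -> : dot (0 : 'cV[R]_m) 0 = 0 by rewrite -(scale0r 0) dotZl mul0r.
rewrite pmulr_rle0// => v0; apply/trmx_inj; rewrite trmx0.
apply/eqP; apply: contraT => /dot_gt0.
by rewrite ltNge v0.
Qed.

(** A lower bound for [T^T] transfers to [T]: with [q = T^T xi] one has
[dot q q = dot z xi], and Cauchy-Schwarz applies. *)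
Lemma coercive_preimage m (T : 'M[R]_m) (theta : R) (z : 'cV[R]_m) :
  0 < theta ->
  (forall xi, theta * dot xi xi <= dot (T^T *m xi) (T^T *m xi)) ->
  exists2 q, T *m q = z & theta * dot q q <= dot z z.
Proof.
move=> t0 hT; have uT := coercive_unitmx t0 hT.
exists (invmx T *m z); first by rewrite mulKVmx.
set q := invmx T *m z.
have Tq : T *m q = z by rewrite mulKVmx.
pose xi := invmx T^T *m q.
have Txi : T^T *m xi = q by rewrite mulKVmx// unitmx_tr.
have := hT xi; rewrite Txi => h1.
have qq : dot q q = dot z xi by rewrite -{2}Txi -dot_mulmxl Tq.
have := dot_sqr_le z xi; rewrite -qq expr2 => h2.
have [->|q0] := eqVneq (dot q q) 0; first by rewrite mulr0 dot_ge0.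
have q1 : 0 < dot q q by rewrite lt_def q0 dot_ge0.
rewrite -(ler_pM2r q1) -mulrA; apply: (le_trans (ler_wpM2l (ltW t0) h2)).
by rewrite mulrCA ler_wpM2l// dot_ge0.
Qed.

(** The columns of [U] and [V] are the paired noise directions of two diffusions
with diffusion matrices [S S^T] and [T T^T]. *)
Definition coupled m d (S T : 'M[R]_m) (U V : 'M[R]_(m, d)) : Prop :=
  U *m U^T = S *m S^T /\ V *m V^T = T *m T^T.

(** The noise driving the second point is reflected in the hyperplane orthogonal to
[q = T^-1 z].  The reflection changes [T] by a multiple of [z q^T], which has two
effects on [S - V]: a component of fixed size appears in the direction [z], and
nothing is added orthogonally to [z], where only [S - T] remains. *)
Lemma reflection_coupling m (S T : 'M[R]_m) (z : 'cV[R]_m) (theta : R) :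
  z != 0 -> 0 < theta ->
  (forall xi, theta * dot xi xi <= dot (T^T *m xi) (T^T *m xi)) ->
  frob2 (S - T) <= theta ->
  exists V : 'M[R]_m, [/\ coupled S T S V,
    theta * dot z z <= dot ((S - V)^T *m z) ((S - V)^T *m z) &
    dot z z * frob2 (S - V) - dot ((S - V)^T *m z) ((S - V)^T *m z)
      <= dot z z * frob2 (S - T)].
Proof.
move=> z0 t0 hT hST.
have [q Tq qz] := coercive_preimage z t0 hT.
have zz := dot_gt0 z0.
have q0 : q != 0.
  by apply: contra z0 => /eqP q0; rewrite -Tq q0 mulmx0.
have qq := dot_gt0 q0.
(* [T - c z q^T] is [T] composed with the reflection that maps [q] to [- q]. *)
pose c := 2 / dot q q.
have cq : c * dot q q = 2 by rewrite mulfVK// gt_eqF.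
have qqE : q^T *m q = (dot q q)%:M.
  rewrite [LHS]mx11_scalar; congr (_%:M); rewrite mxE.
  by apply: eq_bigr => i _; rewrite mxE.
pose V := T - c *: (z *m q^T).
have SV : S - V = S - T + z *m (c *: q)^T.
  by rewrite /V [(c *: q)^T]linearZ /= -scalemxAr opprB addrA addrAC.
have trz : (S - V)^T *m z = (S - T)^T *m z + (dot z z * c) *: q.
  rewrite SV [(_ + _)^T]linearD /= mulmxDl trmx_mul trmxK -mulmxA; congr (_ + _).
  have -> : z^T *m z = (dot z z)%:M.
    rewrite [LHS]mx11_scalar; congr (_%:M); rewrite mxE.
    by apply: eq_bigr => i _; rewrite mxE.
  by rewrite mul_mx_scalar scalerA.
exists V; split.
- split => //; rewrite /V linearB /= mulmxBl !mulmxBr.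
  have -> : T *m (c *: (z *m q^T))^T = c *: (z *m z^T).
    by rewrite linearZ /= trmx_mul trmxK -scalemxAr mulmxA Tq.
  have -> : c *: (z *m q^T) *m T^T = c *: (z *m z^T).
    by rewrite -scalemxAl -mulmxA -trmx_mul Tq.
  have -> : c *: (z *m q^T) *m (c *: (z *m q^T))^T = (2 * c) *: (z *m z^T).
    rewrite linearZ /= trmx_mul trmxK -scalemxAl -scalemxAr scalerA.
    rewrite mulmxA -(mulmxA z) qqE mul_mx_scalar -scalemxAl scalerA.
    by rewrite -cq; congr (_ *: _); ring.
  move: (T *m T^T) (z *m z^T) => A W.
  by apply/matrixP => i j; rewrite !mxE; ring.
- rewrite trz.
  set a := (S - T)^T *m z; set b := _ *: q.
  have h1 : dot b b <= 2 * (dot (a + b) (a + b) + dot a a).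
    have := dotD_sqr_le (a + b) (- a).
    by rewrite dotNl dotNr opprK addrAC subrr add0r.
  have h2 : dot a a <= theta * dot z z.
    by apply: (le_trans (dot_trmx_mul_le _ _)); rewrite ler_wpM2r// ltW.
  have h3 : 4 * (theta * dot z z) <= dot b b.
    rewrite /b dotZl dotZr.
    have -> : dot z z * c * (dot z z * c * dot q q) = 2 * dot z z ^+ 2 * c.
      by rewrite -cq; ring.
    rewrite /c !mulrA ler_pdivlMr//.
    have := ler_wpM2r (ltW zz) qz; lra.
  lra.
- rewrite /frob2 dot_trmx_mul !mulr_sumr -sumrB; apply: ler_sum => k _.
  have -> : col k (S - V) = col k (S - T) + (c * q k 0) *: z.
    rewrite SV; apply/matrixP => i j; rewrite !mxE big_ord1 !mxE (ord1 j).
    by rewrite [z i 0 * _]mulrC.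
  set a := col k _; set l := c * _.
  have := sqr_ge0 (dot a z).
  rewrite !(dotDl, dotDr, dotZl, dotZr) (dotC z a); lra.
Qed.

Lemma independent_coupling m (S T : 'M[R]_m) (z : 'cV[R]_m) :
  let U : 'M[R]_(m, m + m) := row_mx S 0 in
  let V : 'M[R]_(m, m + m) := row_mx 0 T in
  [/\ coupled S T U V, frob2 (U - V) = frob2 S + frob2 T &
    dot ((U - V)^T *m z) ((U - V)^T *m z) =
    dot (S^T *m z) (S^T *m z) + dot (T^T *m z) (T^T *m z)].
Proof.
move=> U V.
have dotE (A B : 'M[R]_m) : dot ((row_mx A B)^T *m z) ((row_mx A B)^T *m z) =
    dot (A^T *m z) (A^T *m z) + dot (B^T *m z) (B^T *m z).
  rewrite tr_row_mx mul_col_mx /dot big_split_ord /=.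
  by congr (_ + _); apply: eq_bigr => i _; rewrite ?col_mxEu ?col_mxEd.
have UV : U - V = row_mx S (- T).
  by rewrite /U /V opp_row_mx add_row_mx oppr0 addr0 add0r.
split.
- by split; rewrite tr_row_mx mul_row_col trmx0 mulmx0 ?addr0 ?add0r.
- rewrite UV !frob2_gram tr_row_mx mul_row_col linearD /=.
  by rewrite linearN mulmxN mulNmx opprK.
- by rewrite UV dotE linearN /= mulNmx dotNl dotNr opprK.
Qed.

(** The reflection needs [S - T] small compared with the ellipticity constant.
Otherwise [dot z z] is bounded below, and independent noises satisfy the same
estimates because a bounded quantity is then a multiple of [dot z z]. *)
Lemma exists_coupling m (S T : 'M[R]_m) (z : 'cV[R]_m) (theta Lam L2 : R) :
  z != 0 -> 0 < theta -> 0 <= L2 ->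
  (forall xi, theta * dot xi xi <= dot (S^T *m xi) (S^T *m xi)) ->
  (forall xi, theta * dot xi xi <= dot (T^T *m xi) (T^T *m xi)) ->
  frob2 S <= Lam -> frob2 T <= Lam -> frob2 (S - T) <= L2 * dot z z ->
  exists d (U V : 'M[R]_(m, d)), [/\ coupled S T U V,
    theta * dot z z <= dot ((U - V)^T *m z) ((U - V)^T *m z) &
    dot z z * frob2 (U - V) - dot ((U - V)^T *m z) ((U - V)^T *m z)
      <= L2 * (1 + 2 * Lam / theta) * dot z z ^+ 2].
Proof.
move=> z0 t0 L0 hS hT S1 T1 ST.
have zz := dot_gt0 z0.
have La0 : 0 <= Lam by exact: le_trans (frob2_ge0 _) S1.
have Lt : 0 <= Lam / theta by rewrite divr_ge0// ltW.
have [Lz|Lz] := leP (L2 * dot z z) theta.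
  have [V [cV V1 V2]] := reflection_coupling z0 t0 hT (le_trans ST Lz).
  exists m, S, V; split => //; apply: (le_trans V2).
  apply: (le_trans (ler_wpM2l (ltW zz) ST)).
  have : 0 <= L2 * dot z z ^+ 2 * (Lam / theta).
    by rewrite mulr_ge0// mulr_ge0// sqr_ge0.
  lra.
have [cUV fUV dUV] := independent_coupling S T z.
exists (m + m)%N, (row_mx S 0), (row_mx 0 T); split => //.
  rewrite dUV; have := hS z; have := hT z.
  have : 0 <= theta * dot z z by rewrite mulr_ge0// ltW.
  lra.
rewrite fUV; apply: (@le_trans _ _ (dot z z * (2 * Lam))).
  have : dot z z * (frob2 S + frob2 T) <= dot z z * (2 * Lam).
    by rewrite ler_wpM2l ?(ltW zz)//; lra.
  by rewrite dUV; have := dot_ge0 (S^T *m z); have := dot_ge0 (T^T *m z); lra.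
have h1 : Lam <= Lam / theta * (L2 * dot z z).
  by rewrite mulrAC -mulrA ler_peMr// ler_pdivlMr// mul1r ltW.
have := ler_wpM2l (ltW zz) h1.
have : 0 <= L2 * dot z z ^+ 2 by rewrite mulr_ge0// sqr_ge0.
lra.
Qed.

End Coupling.

(** * The maximum principle in doubled variables *)

Lemma C2_is_derive (R : realType) (m : nat) (w : 'cV[R]_m -> R) :
  C2 w -> forall y u,
    is_derive y u (fun z => dot u (grad w z)) (dot u (hess w y *m u)).
Proof.
move=> [_ w2] y u.
have -> : (fun z => dot u (grad w z)) = \sum_(i < m) (u i 0 *: partial i w).
  by apply/funext => z; rewrite fct_sumE; apply: eq_bigr => i _; rewrite mxE.
apply: is_derive_eq.
  apply: is_derive_sum => i; apply: is_deriveZ.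
  by have := @C1_is_derive R m _ (w2 i) y u; apply.
apply: eq_bigr => i _; rewrite mxE; congr (_ * _).
by apply: eq_bigr => j _; rewrite !mxE mulrC.
Qed.

Lemma is_derive_quadratic (R : realType) (a b c t : R) :
  is_derive t 1 (fun s => a + b * s + c * s ^+ 2) (b + 2 * c * t).
Proof.
have di := is_derive_id t (1 : R).
have dq := is_deriveD (is_deriveD (is_derive_cst a t 1) (is_deriveZ b di))
  (is_deriveZ c (is_deriveM di di)).
by apply: (is_derive_eq dq); rewrite /GRing.scale /=; ring.
Qed.

(** The profile [F] is taken as a function of the squared distance: along straight
lines both the squared distance and the weight are quadratic polynomials, so that
all derivatives of the barrier are those of a function of one variable. *)
Definition barrier (R : realType) (m : nat) (F : R -> R) (K0 : R)
  (x y : 'cV[R]_m) : R := F (dot (x - y) (x - y)) * (K0 + dot x x + dot y y).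

(** The first- and second-derivative tests at the maximum [(x, y)] for the line
[t |-> (x + t u, y + t v)]. *)
Lemma barrier_direction (R : realType) (m : nat) (F F1 : R -> R) (F2 K0 : R)
    (w : 'cV[R]_m -> R) (x y : 'cV[R]_m) :
  C2 w ->
  (\forall s \near dot (x - y) (x - y), is_derive (s : R) 1 F (F1 s)) ->
  is_derive (dot (x - y) (x - y)) 1 F1 F2 ->
  (forall x' y', w x' - w y' - barrier F K0 x' y'
     <= w x - w y - barrier F K0 x y) ->
  forall u v,
  let s0 := dot (x - y) (x - y) in let s1 := dot (x - y) (u - v) in
  let g0 := K0 + dot x x + dot y y in let g1 := dot x u + dot y v in
  dot u (grad w x) - dot v (grad w y) = 2 * F1 s0 * s1 * g0 + 2 * F s0 * g1 /\
  dot u (hess w x *m u) - dot v (hess w y *m v)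
    <= (4 * F2 * s1 ^+ 2 + 2 * F1 s0 * dot (u - v) (u - v)) * g0
       + 8 * F1 s0 * s1 * g1 + 2 * F s0 * (dot u u + dot v v).
Proof.
move=> w2 dF dF1 wmax u v s0 s1 g0 g1.
have w1 : C1 w by case: w2.
pose s2 := dot (u - v) (u - v); pose g2 := dot u u + dot v v.
pose s (t : R) := s0 + 2 * s1 * t + s2 * t ^+ 2.
pose g (t : R) := g0 + 2 * g1 * t + g2 * t ^+ 2.
pose s' (t : R) := 2 * s1 + 2 * s2 * t.
pose g' (t : R) := 2 * g1 + 2 * g2 * t.
have s00 : s 0 = s0 by rewrite /s mulr0 expr0n mulr0 !addr0.
have g00 : g 0 = g0 by rewrite /g mulr0 expr0n mulr0 !addr0.
have s'00 : s' 0 = 2 * s1 by rewrite /s' mulr0 addr0.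
have g'00 : g' 0 = 2 * g1 by rewrite /g' mulr0 addr0.
have ds (t : R) : is_derive t 1 s (s' t) by exact: is_derive_quadratic.
have dg (t : R) : is_derive t 1 g (g' t) by exact: is_derive_quadratic.
have ds' : is_derive (0 : R) 1 s' (2 * s2).
  have -> : s' = (fun t => 2 * s1 + (2 * s2) * t + 0 * t ^+ 2).
    by apply/funext => t; rewrite mul0r addr0.
  by have := is_derive_quadratic (2 * s1) (2 * s2) 0 0; rewrite !mulr0 addr0.
have dg' : is_derive (0 : R) 1 g' (2 * g2).
  have -> : g' = (fun t => 2 * g1 + (2 * g2) * t + 0 * t ^+ 2).
    by apply/funext => t; rewrite mul0r addr0.
  by have := is_derive_quadratic (2 * g1) (2 * g2) 0 0; rewrite !mulr0 addr0.
pose h := (fun t => w (x + t *: u)) - (fun t => w (y + t *: v)) - (F \o s) * g.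
pose h1 := (fun t => dot u (grad w (x + t *: u)))
  - (fun t => dot v (grad w (y + t *: v)))
  - ((F1 \o s) * s' * g + (F \o s) * g').
pose h2 := dot u (hess w x *m u) - dot v (hess w y *m v) -
   ((4 * F2 * s1 ^+ 2 + 2 * F1 s0 * dot (u - v) (u - v)) * g0
       + 8 * F1 s0 * s1 * g1 + 2 * F s0 * (dot u u + dot v v)).
have hE t : h t = w (x + t *: u) - w (y + t *: v) -
    barrier F K0 (x + t *: u) (y + t *: v).
  rewrite /h /= /barrier; congr (_ - _ * _).
    congr (F _); rewrite /s /s0 /s1 /s2.
    rewrite !(dotDl, dotDr, dotNl, dotNr, dotZl, dotZr).
    by rewrite (dotC u x) (dotC v x) (dotC u y) (dotC v y) (dotC y x) (dotC v u); ring.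
  rewrite /g /g0 /g1 /g2 !(dotDl, dotDr, dotZl, dotZr) (dotC u x) (dotC v y).
  by ring.
have scont : {for 0, continuous s}.
  apply: differentiable_continuous; apply/derivable1_diffP.
  by have [] := ds 0.
have nF : \forall t \near (0:R), is_derive (s t) 1 F (F1 (s t)).
  by move: scont; rewrite /prop_for /continuous_at s00 => /(_ _ dF).
have dh : \forall t \near (0 : R), is_derive (t : R) 1 h (h1 t).
  near=> t.
  have dFt : is_derive (s t) 1 F (F1 (s t)) by near: t.
  apply: is_deriveB.
    apply: is_deriveB; apply: is_derive_line; exact: C1_is_derive.
  have dFs : is_derive t 1 (F \o s) (F1 (s t) * s' t).
    by apply: is_derive1_comp.
  have dFg := is_deriveM dFs (dg t).
  apply: (is_derive_eq dFg).
  rewrite -[RHS]/(F1 (s t) * s' t * g t + F (s t) * g' t) /GRing.scale /=.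
  by ring.
have dh1 : is_derive (0 : R) 1 h1 h2.
  have dw z a : is_derive (0 : R) 1 (fun t => dot a (grad w (z + t *: a)))
      (dot a (hess w z *m a)).
    apply: (@is_derive_line _ _ (fun z => dot a (grad w z))).
    by rewrite scale0r addr0; exact: C2_is_derive.
  apply: (is_deriveB (is_deriveB (dw x u) (dw y v))).
  have dF1t : is_derive (s 0) 1 F1 F2 by rewrite s00.
  have dFt : is_derive (s 0) 1 F (F1 (s 0)) by exact: nbhs_singleton nF.
  have dFs : is_derive (0:R) 1 (F \o s) (F1 (s 0) * s' 0).
    by apply: is_derive1_comp.
  have dF1s : is_derive (0:R) 1 (F1 \o s) (F2 * s' 0).
    by apply: is_derive1_comp.
  have dA := is_deriveM (is_deriveM dF1s ds') (dg 0).
  have dB := is_deriveM dFs dg'.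
  apply: (is_derive_eq (is_deriveD dA dB)).
  rewrite -[LHS]/((F1 (s 0) * s' 0) * g' 0 + g 0 * (F1 (s 0) * (2 * s2) +
    s' 0 * (F2 * s' 0)) + (F (s 0) * (2 * g2) + g' 0 * (F1 (s 0) * s' 0))).
  by rewrite s00 g00 s'00 g'00 /s2 /g2; ring.
have hmax t : h t <= h 0.
  by rewrite !hE !scale0r !addr0.
have [h10 h20] := second_order_max dh dh1 hmax.
split; last by move: h20; rewrite /h2 subr_le0.
move: h10.
rewrite -[h1 0]/(dot u (grad w (x + 0 *: u)) - dot v (grad w (y + 0 *: v))
  - (F1 (s 0) * s' 0 * g 0 + F (s 0) * g' 0)).
by rewrite s00 g00 s'00 g'00 !scale0r !addr0 => e; lra.
Unshelve. all: by end_near. Qed.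

Lemma continuous_col_reindex (R : realType) (m d : nat) (s : 'I_m -> 'I_d) :
  continuous (fun v : 'rV[R]_d => \col_i v 0 (s i) : 'cV[R]_m).
Proof.
move=> u A /nbhs_ballP[e /= e0 eA].
apply/nbhs_ballP; exists e => //= v [_ uv]; apply: eA; split => // i j.
by rewrite !mxE; exact: uv.
Qed.

Lemma continuous_dot (R : realType) (T : topologicalType) (m : nat)
    (f g : T -> 'cV[R]_m) :
  continuous f -> continuous g -> continuous (fun v => dot (f v) (g v)).
Proof.
move=> cf cg; apply: continuous_big => [|i _ v]; first exact: add_continuous.
apply: continuousM.
  apply: (@continuous_comp _ _ _ f (fun M : 'cV[R]_m => M i 0)); first exact: cf.
  exact: coord_continuous.
apply: (@continuous_comp _ _ _ g (fun M : 'cV[R]_m => M i 0)); first exact: cg.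
exact: coord_continuous.
Qed.

Lemma coord_sqr_le_dot (R : realType) (m : nat) (x : 'cV[R]_m) i :
  x i 0 ^+ 2 <= dot x x.
Proof.
rewrite /dot (bigD1 i)//= -expr2 lerDl; apply: sumr_ge0 => j _.
by rewrite -expr2 sqr_ge0.
Qed.

(** Positive values are taken inside a box only, and a maximum over that box is
therefore a global one.  Pairs are encoded as row vectors of length [m + m], for
which boxes are compact. *)
Lemma exists_max_pair (R : realType) (m : nat)
    (Phi : 'cV[R]_m -> 'cV[R]_m -> R) (rho : R) (x1 y1 : 'cV[R]_m) :
  (forall f g : 'rV[R]_(m + m) -> 'cV[R]_m, continuous f -> continuous g ->
    continuous (fun v => Phi (f v) (g v))) ->
  (forall x y, 0 < Phi x y -> dot x x + dot y y <= rho ^+ 2) -> 0 <= rho ->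
  0 < Phi x1 y1 ->
  exists x y, 0 < Phi x y /\ forall x' y', Phi x' y' <= Phi x y.
Proof.
move=> cPhi rhoP rho0 Phi1.
pose f (v : 'rV[R]_(m + m)) : 'cV[R]_m := \col_i v 0 (lshift m i).
pose g (v : 'rV[R]_(m + m)) : 'cV[R]_m := \col_i v 0 (rshift m i).
have cfg : continuous (fun v => Phi (f v) (g v)).
  by apply: cPhi; exact: continuous_col_reindex.
pose A := [set v : 'rV[R]_(m + m) | forall i, `[- rho, rho]%classic (v ord0 i)].
have cA : compact A.
  apply: (@rV_compact _ _ (fun=> `[- rho, rho]%classic)) => _.
  exact: segment_compact.
have inA x y : 0 < Phi x y ->
    exists2 v, v \in A & x = f v /\ y = g v.
  move=> xy; exists (row_mx x^T y^T); last first.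
    by split; apply/matrixP => i j; rewrite [RHS]mxE ?row_mxEl ?row_mxEr mxE ord1.
  rewrite inE => i /=; rewrite in_itv /= -ler_norml.
  rewrite -(ler_pXn2r (_ : (0 < 2)%N)) ?nnegrE// real_normK ?num_real//.
  apply: le_trans (rhoP _ _ xy); rewrite -[i]splitK.
  case: (fintype.split i) => j /=; rewrite ?row_mxEl ?row_mxEr mxE.
    by rewrite (le_trans (coord_sqr_le_dot x j))// lerDl dot_ge0.
  by rewrite (le_trans (coord_sqr_le_dot y j))// lerDr dot_ge0.
have [v1 v1A [xv1 yv1]] := inA _ _ Phi1.
have [|v vA vmax] := EVT_max_rV _ cA (continuous_subspaceT cfg).
  by exists v1; rewrite inE in v1A.
have Phiv : 0 < Phi (f v) (g v).
  by apply: lt_le_trans Phi1 _; rewrite xv1 yv1; exact: vmax.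
exists (f v), (g v); split => // x' y'.
have [/inA[v' v'A [-> ->]]|] := ltP 0 (Phi x' y'); first exact: vmax.
by move=> /le_trans; apply; exact: ltW.
Qed.

(** Summing the second-derivative tests over the paired columns and adding the
first-derivative test along [(b1, b2)]: the generator of the coupled diffusion
satisfies the comparison at the maximum.  The right-hand side is that generator
applied to the barrier. *)
Lemma barrier_generator (R : realType) (m d : nat) (F F1 : R -> R) (F2 K0 : R)
    (w : 'cV[R]_m -> R) (x y b1 b2 : 'cV[R]_m) (S T : 'M[R]_m)
    (U V : 'M[R]_(m, d)) :
  C2 w ->
  (\forall s \near dot (x - y) (x - y), is_derive (s : R) 1 F (F1 s)) ->
  is_derive (dot (x - y) (x - y)) 1 F1 F2 ->
  (forall x' y', w x' - w y' - barrier F K0 x' y'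
     <= w x - w y - barrier F K0 x y) ->
  coupled S T U V ->
  \tr (S *m S^T *m hess w x) + dot b1 (grad w x)
    - (\tr (T *m T^T *m hess w y) + dot b2 (grad w y))
  <= (4 * F2 * dot ((U - V)^T *m (x - y)) ((U - V)^T *m (x - y))
       + 2 * F1 (dot (x - y) (x - y)) * (frob2 (U - V) + dot (x - y) (b1 - b2)))
     * (K0 + dot x x + dot y y)
     + 8 * F1 (dot (x - y) (x - y)) * dot ((U - V)^T *m (x - y)) (U^T *m x + V^T *m y)
     + 2 * F (dot (x - y) (x - y)) * (frob2 S + frob2 T + dot x b1 + dot y b2).
Proof.
move=> w2 dF dF1 wmax [SU TV].
set s0 := dot (x - y) (x - y); set g0 := K0 + dot x x + dot y y; set D := U - V.
have dir := barrier_direction w2 dF dF1 wmax.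
have [] := dir b1 b2; rewrite /= -/s0 -/g0 => drift _.
have second : \sum_k dot (col k U) (hess w x *m col k U) -
    \sum_k dot (col k V) (hess w y *m col k V) <=
    \sum_k ((4 * F2 * (dot (col k D) (x - y) * dot (col k D) (x - y))
             + 2 * F1 s0 * dot (col k D) (col k D)) * g0
       + 8 * F1 s0 * (dot (col k D) (x - y) * dot (col k U) x
                      + dot (col k D) (x - y) * dot (col k V) y)
       + 2 * F s0 * (dot (col k U) (col k U) + dot (col k V) (col k V))).
  rewrite -sumrB; apply: ler_sum => k _.
  have -> : col k D = col k U - col k V by rewrite linearB.
  have [_] := dir (col k U) (col k V); rewrite /= -/s0 -/g0.
  by rewrite (dotC (x - y)) (dotC x) (dotC y); lra.
have split_sum (a b c e p q : 'I_d -> R) :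
    \sum_k ((4 * F2 * a k + 2 * F1 s0 * b k) * g0 + 8 * F1 s0 * (c k + e k)
      + 2 * F s0 * (p k + q k)) =
    (4 * F2 * \sum_k a k + 2 * F1 s0 * \sum_k b k) * g0
      + 8 * F1 s0 * (\sum_k c k + \sum_k e k)
      + 2 * F s0 * (\sum_k p k + \sum_k q k).
  by rewrite -!big_split !mulr_sumr -!big_split mulr_suml -!big_split.
move: second; rewrite split_sum -!dot_trmx_mul -/(frob2 D).
rewrite -/(frob2 U) -/(frob2 V) -!mxtrace_gram SU TV.
have -> : frob2 U = frob2 S by rewrite !frob2_gram SU.
have -> : frob2 V = frob2 T by rewrite !frob2_gram TV.
rewrite [dot _ (U^T *m x + _)]dotDr => second.
have arith (t1 t2 d1 d2 q fr dd c fs ft e1 e2 f1 f0 g : R) :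
    t1 - t2 <= (4 * F2 * q + 2 * f1 * fr) * g + 8 * f1 * c + 2 * f0 * (fs + ft) ->
    d1 - d2 = 2 * f1 * dd * g + 2 * f0 * (e1 + e2) ->
    t1 + d1 - (t2 + d2) <= (4 * F2 * q + 2 * f1 * (fr + dd)) * g + 8 * f1 * c
      + 2 * f0 * (fs + ft + e1 + e2).
  move=> h1 h2; have -> : t1 + d1 - (t2 + d2) = (t1 - t2) + (d1 - d2) by ring.
  rewrite h2; apply: (le_trans (lerD h1 (lexx _))).
  by rewrite le_eqVlt; apply/orP; left; apply/eqP; ring.
exact: arith second drift.
Qed.

(** * The profile and the estimates of its generator *)

Section Profile.
Context {R : realType}.
Variables (A N eta : R).

Definition exp_sqrt (s : R) : R := expR (- N * Num.sqrt s).

Lemma is_derive_exp_sqrt (s : R) : 0 < s ->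
  is_derive s 1 exp_sqrt (- N / 2 * (exp_sqrt s * (Num.sqrt s)^-1)).
Proof.
move=> s0; have ds := is_derive1_sqrt s0.
have dl : is_derive s 1 (- N *: (@Num.sqrt R)) (- N *: (2 * Num.sqrt s)^-1).
  exact: is_deriveZ.
have de := is_derive_expR ((- N *: (@Num.sqrt R)) s).
apply: (is_derive_eq (is_derive1_comp de dl)).
by rewrite /exp_sqrt /GRing.scale /= invfM; ring.
Qed.

Definition concave_profile (s : R) : R := A * (1 + eta - exp_sqrt s).

Definition concave_profile1 (s : R) : R :=
  A * N / 2 * (exp_sqrt s * (Num.sqrt s)^-1).

Lemma is_derive_concave_profile (s : R) : 0 < s ->
  is_derive s 1 concave_profile (concave_profile1 s).
Proof.
move=> s0; have de := is_derive_exp_sqrt s0.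
have -> : concave_profile = cst (A * (1 + eta)) - A *: exp_sqrt.
  by apply/funext => t; rewrite /concave_profile mulrBr.
apply: is_derive_eq; rewrite /concave_profile1 /GRing.scale /=; ring.
Qed.

Lemma is_derive_concave_profile1 (s : R) : 0 < s ->
  let r := Num.sqrt s in
  is_derive s 1 concave_profile1
    (A * exp_sqrt s * (- N ^+ 2 / (4 * r ^+ 2) - N / (4 * r ^+ 3))).
Proof.
move=> s0 r; have de := is_derive_exp_sqrt s0.
have r0 : 0 < r by rewrite sqrtr_gt0.
have ds := is_derive1_sqrt s0.
have dV : is_derive s 1 (fun t : R => (Num.sqrt t)^-1) (- r ^- 2 * (2 * r)^-1).
  by apply: is_deriveV; rewrite gt_eqF.
have -> : concave_profile1 =
    (A * N / 2) *: (exp_sqrt * (fun t : R => (Num.sqrt t)^-1)).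
  by apply/funext.
apply: is_derive_eq; rewrite -/r /GRing.scale /= -/r.
by field; rewrite gt_eqF.
Qed.

End Profile.

(** The generator of the barrier at distance [r <= R1].  Here [E = exp (- N r)],
[QD] is the squared component of [U - V] along [x - y] multiplied by [r^2],
[fD] the squared Frobenius norm of [U - V], [zb] the drift term, [c] the cross
term between profile and weight, [g0] the weight, and [rest] half the generator
of the weight.  The singular terms in [1 / r^3] combine to
[(r^2 fD - QD) / r^3], which is harmless because the noise orthogonal to [x - y]
is of order [r]. *)
Lemma generator_estimate (R : realType)
    (A N r E QD fD zb c g0 F0 rest theta Q Lb Lam R1 Cg : R) :
  0 < A -> 0 < N -> 0 < r -> r <= R1 -> 0 < E -> 0 <= Q -> 0 <= Lb ->
  0 <= F0 -> F0 <= 2 * A -> 0 <= Cg ->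
  theta * r ^+ 2 <= QD -> r ^+ 2 * fD - QD <= Q * r ^+ 4 ->
  zb <= Lb * r ^+ 2 -> c <= 2 * Lam * r * g0 -> rest <= Cg ->
  4 * Cg + 1 <= g0 * E -> 0 <= g0 ->
  1 <= N * (N * theta - ((Q + Lb) * R1 + 8 * Lam)) ->
  (4 * (A * E * (- N ^+ 2 / (4 * r ^+ 2) - N / (4 * r ^+ 3))) * QD
     + 2 * (A * N / 2 * (E * r^-1)) * (fD + zb)) * g0
   + 8 * (A * N / 2 * (E * r^-1)) * c + 2 * F0 * rest <= - A.
Proof.
move=> A0 N0 r0 rR E0 Q0 Lb0 F00 F0A Cg0 hQD hfD hzb hc hrest hg g00 hN.
have rn : r != 0 by rewrite gt_eqF.
have i1 : theta <= QD / r ^+ 2 by rewrite ler_pdivlMr ?exprn_gt0.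
have i2 : (r ^+ 2 * fD - QD) / r ^+ 3 <= Q * R1.
  rewrite ler_pdivrMr ?exprn_gt0//; apply: (le_trans hfD).
  rewrite exprS mulrA ler_wpM2r ?exprn_ge0 ?(ltW r0)//.
  by rewrite ler_wpM2l.
have i3 : zb / r <= Lb * R1.
  rewrite ler_pdivrMr//; apply: (le_trans hzb).
  by rewrite expr2 mulrA ler_wpM2r ?(ltW r0)// ler_wpM2l.
have i4 : c / r <= 2 * Lam * g0.
  by rewrite ler_pdivrMr// (mulrAC _ g0).
have -> : (4 * (A * E * (- N ^+ 2 / (4 * r ^+ 2) - N / (4 * r ^+ 3))) * QD
     + 2 * (A * N / 2 * (E * r^-1)) * (fD + zb)) * g0
   + 8 * (A * N / 2 * (E * r^-1)) * c + 2 * F0 * rest =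
   A * E * N * (g0 * (- N * (QD / r ^+ 2) + (r ^+ 2 * fD - QD) / r ^+ 3 + zb / r)
    + 4 * (c / r)) + 2 * F0 * rest by field.
have AEN : 0 < A * E * N by rewrite !mulr_gt0.
have j1 : - N * (QD / r ^+ 2) <= - N * theta by rewrite ler_nM2l// oppr_lt0.
have j2 : g0 * (- N * (QD / r ^+ 2) + (r ^+ 2 * fD - QD) / r ^+ 3 + zb / r)
    + 4 * (c / r) <= g0 * (- (N * theta - ((Q + Lb) * R1 + 8 * Lam))).
  apply: (@le_trans _ _ (g0 * (- N * theta + Q * R1 + Lb * R1) + 4 * (2 * Lam * g0))).
    rewrite lerD//; last by rewrite ler_pM2l.
    by rewrite ler_wpM2l// lerD// lerD.
  by rewrite le_eqVlt; apply/orP; left; apply/eqP; ring.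
have j3 := ler_wpM2l (ltW AEN) j2.
have j4 : F0 * rest <= 2 * A * Cg.
  apply: (le_trans (ler_wpM2l F00 hrest)).
  by rewrite ler_wpM2r.
have j5 : A * (g0 * E) * 1 <= A * (g0 * E) * (N * (N * theta - ((Q + Lb) * R1 + 8 * Lam))).
  by rewrite ler_wpM2l// mulr_ge0 ?(ltW A0)// mulr_ge0// ltW.
have j6 := ler_wpM2l (ltW A0) hg.
lra.
Qed.

(** Subtracting the equations at the two points, with [dw] the discount rate,
[t1], [t2] the second-order terms, [d1], [d2] the drift terms and [f1], [f2] the
sources. *)
Lemma pde_difference_gt (R : realType) (M dw wx wy t1 t2 d1 d2 f1 f2 : R) :
  0 < dw -> wy < wx -> f1 <= M -> 0 <= f2 ->
  dw * wx - t1 - d1 - f1 = 0 -> dw * wy - t2 - d2 - f2 = 0 ->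
  - M < t1 + d1 - (t2 + d2).
Proof.
move=> dw0; rewrite -subr_gt0 => wxy f1M f20 e1 e2.
have := mulr_gt0 dw0 wxy; rewrite mulrBr => h.
lra.
Qed.

(** The cross term [aW] is handled by [2 r aW <= a2 + r^2 W2], where the weight [r]
balances the order [r^2] of [a2] against the order 1 of [W2]. *)
Lemma cross_term_le (R : realType) (a2 aW W2 r Lam g : R) :
  0 < r -> 0 <= a2 + r ^+ 2 * W2 - 2 * r * aW -> a2 <= 4 * Lam * r ^+ 2 ->
  W2 <= 2 * Lam * g -> 
  aW <= r * (2 * Lam + Lam * g).
Proof.
move=> r0 h1 h2 h3.
have h4 := ler_wpM2l (sqr_ge0 r) h3.
rewrite -(ler_pM2l (_ : 0 < 2 * r)) ?mulr_gt0//.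
lra.
Qed.

Lemma profile_bounds (R : realType) (M eta e : R) :
  0 < M -> 0 < eta -> eta <= 1 -> 0 < e -> e <= 1 ->
  0 <= M * (1 + eta - e) /\ M * (1 + eta - e) <= 2 * M.
Proof.
move=> M0 eta0 eta1 e0 e1; split; first by rewrite mulr_ge0 ?(ltW M0)//; lra.
by rewrite mulrC ler_pM2r//; lra.
Qed.

(** At distance [r >= R1] the profile is the constant [M * (1 + eta - e)], so the
generator of the barrier is this constant times that of the weight. *)
Lemma far_estimate (R : realType) (M eta e rest : R) :
  0 < M -> 0 < eta -> e <= 2^-1 -> rest <= -1 ->
  2 * (M * (1 + eta - e)) * rest <= - M.
Proof.
move=> M0 eta0 e1 hr.
have h : 1 / 2 <= 1 + eta - e by lra.
have h2 := ler_wpM2l (ltW M0) h.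
have F0 : 0 <= M * (1 + eta - e) by apply: le_trans h2; lra.
have := ler_wpM2l F0 hr; lra.
Qed.

(** * The two-point estimate *)

Lemma barrier_le (R : realType) (m : nat) (F G : R -> R) (K0 : R)
    (x y : 'cV[R]_m) :
  0 <= K0 -> (forall s, F s <= G s) -> barrier F K0 x y <= barrier G K0 x y.
Proof.
move=> K00 FG; rewrite /barrier ler_wpM2r//.
by rewrite !addr_ge0// dot_ge0.
Qed.

Lemma continuous_barrier (R : realType) (m : nat) (F : R -> R) (K0 : R)
    (T : topologicalType) (f g : T -> 'cV[R]_m) :
  continuous F -> continuous f -> continuous g ->
  continuous (fun v => barrier F K0 (f v) (g v)).
Proof.
move=> cF cf cg v.
have cfg : continuous (fun v => f v - g v).
  by move=> u; exact: cvgB (cf u) (cg u).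
have c1 : continuous (fun v => F (dot (f v - g v) (f v - g v))).
  move=> u; apply: (@continuous_comp _ _ _ (fun v => dot (f v - g v) (f v - g v)) F);
    last exact: cF.
  exact: (continuous_dot cfg cfg).
have cff : continuous (fun v => dot (f v) (f v)) by exact: continuous_dot.
have cgg : continuous (fun v => dot (g v) (g v)) by exact: continuous_dot.
have c2 : continuous (fun v => K0 + dot (f v) (f v) + dot (g v) (g v)).
  by move=> u; exact: cvgD (cvgD (cvg_cst _) (cff u)) (cgg u).
exact: continuousM (c1 v) (c2 v).
Qed.

Section TwoPoint.
Context {R : realType} (m : nat).
Variables (b : 'cV[R]_m -> 'cV[R]_m) (tau : 'cV[R]_m -> 'M[R]_m).
Variables (theta Lam L2 Lb B C0 M : R).
Hypotheses (theta0 : 0 < theta) (Lam0 : 0 <= Lam) (L20 : 0 <= L2)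
  (Lb0 : 0 <= Lb) (B0 : 0 < B) (C00 : 0 <= C0) (M0 : 0 < M).
Hypothesis tau_elliptic :
  forall y xi, theta * dot xi xi <= dot ((tau y)^T *m xi) ((tau y)^T *m xi).
Hypothesis tau_bounded : forall y, frob2 (tau y) <= Lam.
Hypothesis tau_lip :
  forall x y, frob2 (tau x - tau y) <= L2 * dot (x - y) (x - y).
Hypothesis b_lip :
  forall x y, dot (x - y) (b x - b y) <= Lb * dot (x - y) (x - y).
Hypothesis b_dissipative : forall y, dot y (b y) <= C0 - B * dot y y.

(* [Q] is the constant of [exists_coupling] and [Cg] bounds half the generator of
   the weight.  At distance at least [R1] dissipativity exceeds [Cg] by 1.  [K1]
   collects the terms of first order in [N] that [N ^+ 2 * theta] must absorb;
   the summand [R1^-1] of [N] ensures [N * R1 >= 1], hence [E1 <= 1 / 2].  [K0]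
   is such that [K0 * E1] outweighs the growth of the weight. *)
Let Q := L2 * (1 + 2 * Lam / theta).
Let Cg := 2 * Lam + 2 * C0.
Let R1 := Num.sqrt (2 * (Cg + 1) / B).
Let K1 := (Q + Lb) * R1 + 8 * Lam.
Let N := (K1 + 1) / theta + 1 + R1^-1.
Let E1 := expR (- N * R1).
Let K0 := (4 * Cg + 1) / E1.

Let Cg0 : 0 <= Cg.
Proof. by rewrite /Cg addr_ge0// mulr_ge0. Qed.

Let R10 : 0 < R1.
Proof. by rewrite sqrtr_gt0 divr_gt0// mulr_gt0// ltr_wpDl. Qed.

Let Q0 : 0 <= Q.
Proof.
by rewrite mulr_ge0// addr_ge0// divr_ge0 ?(ltW theta0)// mulr_ge0.
Qed.

Let K10 : 0 <= K1.
Proof.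
by rewrite /K1 addr_ge0 ?mulr_ge0 ?addr_ge0 ?(ltW R10).
Qed.

Let N1 : 1 <= N.
Proof.
have a1 : 0 <= (K1 + 1) / theta.
  by apply: divr_ge0; [exact: addr_ge0|exact: ltW].
have a2 : 0 <= R1^-1 by rewrite invr_ge0 ltW.
rewrite /N; lra.
Qed.

Let N0 : 0 < N. Proof. exact: lt_le_trans N1. Qed.

Let N_large : 1 <= N * (N * theta - K1).
Proof.
have a2 : 0 <= R1^-1 by rewrite invr_ge0 ltW.
have -> : N * theta - K1 = 1 + theta + R1^-1 * theta.
  by rewrite /N; field; rewrite !gt_eqF.
have h : 1 <= 1 + theta + R1^-1 * theta.
  by rewrite -addrA lerDl addr_ge0// ?mulr_ge0// ltW.
by have := ler_pM ler01 ler01 N1 h; rewrite mulr1.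
Qed.

Let E10 : 0 < E1. Proof. exact: expR_gt0. Qed.

Let E1_half : E1 <= 2^-1.
Proof.
have NR : 1 <= N * R1.
  rewrite /N mulrDl mulVf ?gt_eqF// lerDr mulr_ge0 ?(ltW R10)//.
  apply: addr_ge0 => //; apply: divr_ge0; last exact: ltW.
  exact: addr_ge0.
rewrite /E1 mulNr expRN lef_pV2 ?posrE ?expR_gt0//.
by have := expR_ge1Dx (N * R1); lra.
Qed.

Let K01 : 1 <= K0.
Proof.
rewrite ler_pdivlMr// mul1r; apply: (le_trans E1_half).
by have := Cg0; lra.
Qed.

Let K00 : 0 < K0. Proof. exact: lt_le_trans K01. Qed.

(* The minimum of two smooth profiles.  At its kink the barrier is not
   differentiable, but it is touched from above by either smooth branch, and this
   is enough for the maximum principle. *)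
Let capped (eta s : R) : R := M * (1 + eta - Num.max (exp_sqrt N s) E1).

Let capped_concave eta s : capped eta s <= concave_profile M N eta s.
Proof. by rewrite ler_pM2l// lerD2l lerN2 le_max lexx. Qed.

Let capped_const eta s : capped eta s <= M * (1 + eta - E1).
Proof. by rewrite ler_pM2l// lerD2l lerN2 le_max lexx orbT. Qed.

Let exp_sqrt_le1 s : exp_sqrt N s <= 1.
Proof.
by rewrite -expR0 ler_expR mulNr oppr_le0 mulr_ge0 ?sqrtr_ge0// ltW.
Qed.

Let capped_ge eta s : M * eta <= capped eta s.
Proof.
rewrite ler_pM2l//.
have : Num.max (exp_sqrt N s) E1 <= 1.
  rewrite ge_max exp_sqrt_le1/= (le_trans E1_half)//; lra.
lra.
Qed.

Let capped_continuous eta : continuous (capped eta).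
Proof.
have c1 : continuous (fun s => - N * Num.sqrt s).
  by move=> u; exact: cvgM (cvg_cst _) (@sqrt_continuous R u).
have c2 : continuous (exp_sqrt N).
  move=> u; apply: (@continuous_comp _ _ _ (fun s => - N * Num.sqrt s) expR).
    exact: c1.
  exact: continuous_expR.
have c3 : continuous (fun s => Num.max (exp_sqrt N s) E1).
  move=> u; apply: (@continuous_max _ _ (exp_sqrt N) (fun=> E1)); first exact: c2.
  exact: cst_continuous.
by move=> s; exact: cvgM (cvg_cst _) (cvgB (cvg_cst _) (c3 s)).
Qed.

Let exp_sqrt_cap s : (E1 <= exp_sqrt N s) = (Num.sqrt s <= R1).
Proof. by rewrite ler_expR !mulNr lerN2 ler_pM2l. Qed.

(* A positive maximum off the diagonal would make the generator of the barrier both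
   greater than [- M], by the equation, and at most [- M], by the choice of the
   constants. *)
Let no_positive_max (delta eta : R) (f w : 'cV[R]_m -> R) (x y : 'cV[R]_m) :
  0 < delta -> 0 < eta -> eta <= 1 -> C2 w -> (forall y, 0 <= f y <= M) ->
  (forall y, delta * w y - \tr (tau y *m (tau y)^T *m hess w y)
          - dot (b y) (grad w y) - f y = 0) ->
  (forall x' y', w x' - w y' - barrier (capped eta) K0 x' y'
    <= w x - w y - barrier (capped eta) K0 x y) ->
  w x - w y <= barrier (capped eta) K0 x y.
Proof.
move=> delta0 eta0 eta1 w2 fM eqw wmax; rewrite leNgt; apply/negP => wxy.
have g_ge0 (u v : 'cV[R]_m) : 0 <= K0 + dot u u + dot v v.
  by rewrite !addr_ge0 ?dot_ge0// ltW.
have bar0 : 0 <= barrier (capped eta) K0 x y.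
  rewrite mulr_ge0//; apply: le_trans (capped_ge _ _).
  by rewrite mulr_ge0// ltW.
have xy : x - y != 0.
  rewrite subr_eq0; apply: contraTneq wxy => ->.
  rewrite subrr -leNgt mulr_ge0//; apply: le_trans (capped_ge _ _).
  by rewrite mulr_ge0// ltW.
have s0 := dot_gt0 xy.
pose r := Num.sqrt (dot (x - y) (x - y)).
have r0 : 0 < r by rewrite sqrtr_gt0.
have r2 : dot (x - y) (x - y) = r ^+ 2 by rewrite sqr_sqrtr ?ltW.
have r4 : r ^+ 4 = dot (x - y) (x - y) ^+ 2 by rewrite r2 -exprM.
have [d [U [V [UV ell perp]]]] := exists_coupling xy theta0 L20 (tau_elliptic x)
  (tau_elliptic y) (tau_bounded x) (tau_bounded y) (tau_lip x y).
have frob_U : frob2 (tau x) = frob2 U by rewrite !frob2_gram UV.1.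
have frob_V : frob2 (tau y) = frob2 V by rewrite !frob2_gram UV.2.
have lower : - M < \tr (tau x *m (tau x)^T *m hess w x) + dot (b x) (grad w x)
    - (\tr (tau y *m (tau y)^T *m hess w y) + dot (b y) (grad w y)).
  have wyx : w y < w x by rewrite -subr_gt0 (le_lt_trans bar0).
  have /andP[_ fxM] := fM x; have /andP[fy0 _] := fM y.
  exact: pde_difference_gt delta0 wyx fxM fy0 (eqw x) (eqw y).
(* A smooth profile touching the capped one from above inherits the maximum. *)
have touch F : (forall s, capped eta s <= F s) ->
    capped eta (dot (x - y) (x - y)) = F (dot (x - y) (x - y)) ->
    forall x' y', w x' - w y' - barrier F K0 x' y'
      <= w x - w y - barrier F K0 x y.
  move=> cF eF x' y'.
  rewrite {2}/barrier -eF -/(barrier (capped eta) K0 x y).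
  apply: le_trans (wmax x' y').
  by rewrite lerD2l lerN2 barrier_le// ltW.
have rest : frob2 (tau x) + frob2 (tau y) + dot x (b x) + dot y (b y) <=
    Cg - B * (dot x x + dot y y).
  apply: (@le_trans _ _ (Lam + Lam + (C0 - B * dot x x) + (C0 - B * dot y y))).
    by rewrite !lerD.
  by rewrite le_eqVlt; apply/orP; left; apply/eqP; rewrite /Cg; ring.
have xxyy : 0 <= B * (dot x x + dot y y).
  by rewrite mulr_ge0 ?addr_ge0 ?dot_ge0// ltW.
have [rR|rR] := leP r R1.
- have capE : capped eta (dot (x - y) (x - y)) =
      concave_profile M N eta (dot (x - y) (x - y)).
    by rewrite /capped max_l// exp_sqrt_cap.
  have dF : \forall s \near dot (x - y) (x - y),
      is_derive (s : R) 1 (concave_profile M N eta) (concave_profile1 M N s).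
    near=> s; apply: is_derive_concave_profile.
    by near: s; exact: lt_nbhsr.
  have := barrier_generator (b x) (b y) w2 dF (is_derive_concave_profile1 M N s0)
    (touch _ (capped_concave eta) capE) UV.
  apply/negP; rewrite -ltNge; apply: le_lt_trans lower.
  have [F00 F02] := profile_bounds M0 eta0 eta1
    (expR_gt0 (- N * Num.sqrt (dot (x - y) (x - y)))) (exp_sqrt_le1 _).
  rewrite /concave_profile1 -/r.
  apply: (generator_estimate (theta := theta) (Q := Q) (Lb := Lb) (Lam := Lam)
    (R1 := R1) (Cg := Cg)) => //.
  + exact: expR_gt0.
  + by rewrite -r2.
  + by rewrite -r2 r4.
  + by rewrite -r2.
  + set a := (U - V)^T *m (x - y); set W := U^T *m x + V^T *m y.
    have Da : dot a a <= 4 * Lam * r ^+ 2.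
      apply: (le_trans (dot_trmx_mul_le _ _)); rewrite r2 ler_wpM2r ?sqr_ge0//.
      apply: (le_trans (frob2B_le _ _)); rewrite -frob_U -frob_V.
      rewrite (_ : 4 * Lam = 2 * (Lam + Lam)); last by ring.
      by rewrite ler_pM2l// lerD.
    have WW : dot W W <= 2 * Lam * (dot x x + dot y y).
      apply: (le_trans (dotD_sqr_le _ _)); rewrite -mulrA ler_pM2l// mulrDr.
      apply: lerD; apply: (le_trans (dot_trmx_mul_le _ _));
        by rewrite ler_wpM2r ?dot_ge0// -?frob_U -?frob_V.
    apply: (le_trans (cross_term_le r0 (dotB_scale_ge0 r a W) Da WW)).
    rewrite [2 * Lam * r]mulrC -mulrA ler_pM2l//.
    rewrite (_ : 2 * Lam + _ = 2 * Lam * (1 + 2^-1 * (dot x x + dot y y)));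
      last by field.
    rewrite ler_wpM2l ?mulr_ge0// -addrA.
    apply: lerD; last by rewrite ler_piMl ?addr_ge0 ?dot_ge0 ?invf_le1// ler1n.
    exact: K01.
  + by apply: (le_trans rest); rewrite lerBlDr lerDl.
  + have <- : K0 * E1 = 4 * Cg + 1 by rewrite divfK// gt_eqF.
    rewrite ler_pM ?(ltW K00) ?(ltW E10)//; last by rewrite exp_sqrt_cap.
    by rewrite -addrA lerDl addr_ge0 ?dot_ge0.
- have capE : capped eta (dot (x - y) (x - y)) = M * (1 + eta - E1).
    by rewrite /capped max_r// leNgt; apply/negP => /ltW; rewrite exp_sqrt_cap leNgt rR.
  have dF : \forall s \near dot (x - y) (x - y),
      is_derive (s : R) 1 (fun=> M * (1 + eta - E1)) 0.
    by near=> s; exact: is_derive_cst.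
  have dF1 : is_derive (dot (x - y) (x - y)) 1 (fun=> 0 : R) 0.
    exact: is_derive_cst.
  have := barrier_generator (b x) (b y) w2 dF dF1
    (touch _ (capped_const eta) capE) UV.
  apply/negP; rewrite -ltNge; apply: le_lt_trans lower.
  rewrite !(mulr0, mul0r, add0r).
  have far : Cg + 1 <= B * (dot x x + dot y y).
    have R12 : R1 ^+ 2 = 2 * (Cg + 1) / B.
      by rewrite sqr_sqrtr// divr_ge0 ?(ltW B0)// mulr_ge0// addr_ge0.
    have h1 : R1 ^+ 2 <= 2 * (dot x x + dot y y).
      have := dotD_sqr_le x (- y); rewrite dotNl dotNr opprK r2.
      by apply: le_trans; rewrite ler_pXn2r ?nnegrE ?ltW.
    by move: h1; rewrite R12 ler_pdivrMr// -mulrA ler_pM2l// mulrC.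
  apply: far_estimate => //.
  by apply: (le_trans rest); rewrite lerBlDr -lerBlDl opprK.
Unshelve. all: by end_near. Qed.

Lemma two_point_bound : exists K K' : R, [/\ 0 <= K, 0 <= K' &
  forall (delta : R) (f w : 'cV[R]_m -> R),
  0 < delta -> C2 w -> bounded_fun w -> (forall y, 0 <= f y <= M) ->
  (forall y, delta * w y - \tr (tau y *m (tau y)^T *m hess w y)
          - dot (b y) (grad w y) - f y = 0) ->
  forall x y, w x - w y <= K * enorm (x - y) * (K' + dot x x + dot y y)].
Proof.
exists (M * N), K0; split; [by rewrite mulr_ge0 ?ltW|exact: ltW|].
move=> delta f w delta0 w2 wb fM eqw x1 y1.
have cw : continuous w by case: w2 => -[].
have [W Wb] : exists W : R, forall y, `|w y| <= W.
  have [W [_ Wb]] := wb; exists (W + 1) => y.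
  by apply: (Wb (W + 1)) => //; rewrite ltrDl.
have bound eta : 0 < eta -> eta <= 1 ->
    w x1 - w y1 <= barrier (capped eta) K0 x1 y1.
  move=> eta0 eta1; rewrite leNgt; apply/negP; rewrite -subr_gt0 => pos1.
  pose Phi x y := w x - w y - barrier (capped eta) K0 x y.
  have Me : 0 < M * eta by rewrite mulr_gt0.
  have PhiP x y : 0 < Phi x y ->
      dot x x + dot y y <= Num.sqrt (2 * W / (M * eta)) ^+ 2.
    rewrite subr_gt0 => /ltW wxy.
    have h : M * eta * (dot x x + dot y y) <= 2 * W.
      have h1 : w x - w y <= 2 * W.
        rewrite mulr_natl mulr2n lerD//; first exact: le_trans (ler_norm _) (Wb _).
        by rewrite (le_trans _ (Wb y))// -normrN ler_norm.
      apply: le_trans h1; apply: le_trans wxy; rewrite /barrier.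
      apply: ler_pM; rewrite ?(ltW Me) ?addr_ge0 ?dot_ge0//.
      by rewrite -addrA lerDr ltW.
    have h2 : dot x x + dot y y <= 2 * W / (M * eta).
      by rewrite ler_pdivlMr// mulrC.
    by rewrite sqr_sqrtr//; apply: le_trans h2; rewrite addr_ge0 ?dot_ge0.
  have cPhi (g h : 'rV[R]_(m + m) -> 'cV[R]_m) : continuous g -> continuous h ->
      continuous (fun v => Phi (g v) (h v)).
    move=> cg ch v.
    have cb := continuous_barrier (K0 := K0) (@capped_continuous eta) cg ch.
    have cwg : continuous (w \o g).
      by move=> u; apply: continuous_comp; [exact: cg|exact: cw].
    have cwh : continuous (w \o h).
      by move=> u; apply: continuous_comp; [exact: ch|exact: cw].
    exact: cvgB (cvgB (cwg v) (cwh v)) (cb v).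
  have [x [y [Phixy Phimax]]] := exists_max_pair cPhi PhiP (sqrtr_ge0 _) pos1.
  have := no_positive_max delta0 eta0 eta1 w2 fM eqw Phimax.
  by rewrite leNgt -subr_gt0 Phixy.
set G := K0 + dot x1 x1 + dot y1 y1.
have G0 : 0 < G by rewrite !ltr_wpDr ?dot_ge0.
(* Letting [eta] tend to 0. *)
apply/ler_addgt0Pr => e e0.
pose eta := Num.min 1 (e / (M * G)).
have MG : 0 < M * G by rewrite mulr_gt0.
have eta0 : 0 < eta by rewrite lt_min ltr01 divr_gt0.
have eta1 : eta <= 1 by rewrite ge_min lexx.
have etae : M * eta * G <= e.
  by rewrite mulrAC mulrC -ler_pdivlMr// ge_min lexx orbT.
apply: (le_trans (bound _ eta0 eta1)).
apply: (@le_trans _ _ (M * (N * enorm (x1 - y1) + eta) * G)); last first.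
  have -> : M * (N * enorm (x1 - y1) + eta) * G =
    M * N * enorm (x1 - y1) * G + M * eta * G by ring.
  by rewrite lerD2l.
rewrite ler_wpM2r ?(ltW G0)//; apply: (le_trans (capped_concave _ _)).
rewrite ler_pM2l//.
(* [1 - exp (- N r) <= N r] makes the bound linear in the distance. *)
have := expR_ge1Dx (- N * enorm (x1 - y1)); rewrite /exp_sqrt -/(enorm _).
by move: (expR _) => ex; lra.
Qed.

End TwoPoint.

(** * From the hypotheses on the coefficients to the gradient bound *)

Lemma norm_coord_le (R : realType) (m d : nat) (A : 'M[R]_(m, d)) i j :
  `|A i j| <= `|A|.
Proof.
rewrite [leRHS]/Num.Def.normr /= mx_normrE.
exact: (le_bigmax _ (fun ij => `|A ij.1 ij.2|) (i, j)).
Qed.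

(** The coefficients are Lipschitz and bounded for the sup norm of matrices, while the
two-point estimate is Euclidean; this lemma and the next two compare the norms. *)
Lemma frob2_le_norm (R : realType) (m d : nat) (A : 'M[R]_(m, d)) :
  frob2 A <= (m * d)%:R * `|A| ^+ 2.
Proof.
rewrite mulnC natrM -mulrA -[d in d%:R]card_ord mulr_natl -sumr_const.
apply: ler_sum => k _.
rewrite -[m in m%:R]card_ord mulr_natl -sumr_const.
apply: ler_sum => i _; rewrite !mxE -expr2 -real_normK ?num_real//.
by rewrite ler_pXn2r ?nnegrE// norm_coord_le.
Qed.

Lemma dot_le_norm (R : realType) (m : nat) (v : 'cV[R]_m) :
  dot v v <= m%:R * `|v| ^+ 2.
Proof.
have := frob2_le_norm v; rewrite muln1 /frob2 big_ord1.
by rewrite (_ : col 0 v = v)//; apply/matrixP => i j; rewrite mxE ord1.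
Qed.

Lemma norm_le_dot (R : realType) (m : nat) (v : 'cV[R]_m) :
  `|v| ^+ 2 <= dot v v.
Proof.
have [v0|/mx_norm_neq0[i vi]] := eqVneq (mx_norm v) 0.
  by rewrite [`|v|]v0 expr0n dot_ge0.
rewrite [`|v|]vi real_normK ?num_real// [i.2]ord1.
exact: coord_sqr_le_dot.
Qed.

Lemma bounded_funE (R : realType) (T : Type) (V : normedModType R) (f : T -> V) :
  bounded_fun f -> exists2 W : R, 0 <= W & forall y, `|f y| <= W.
Proof.
move=> [W [_ Wb]]; exists (`|W| + 1) => [|y]; first by rewrite addr_ge0.
by apply: (Wb (`|W| + 1)) => //; rewrite ltr_pwDr// ler_norm.
Qed.

Lemma lipschitzE (R : realType) (V W : normedModType R) (f : V -> W) :
  lipschitz f -> exists2 L : R, 0 <= L & forall x y, `|f x - f y| <= L * `|x - y|.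
Proof.
move=> [L [_ Lb]]; exists (`|L| + 1) => [|x y]; first by rewrite addr_ge0.
by apply: (Lb (`|L| + 1) _ (x, y)) => //; rewrite ltr_pwDr// ler_norm.
Qed.

Lemma partial_bound (R : realType) (m : nat) (w : 'cV[R]_m -> R) (i : 'I_m)
    (y : 'cV[R]_m) (c : R) :
  derivable w y (delta_mx i 0) ->
  (forall h : R, `|h| <= 1 -> `|w (y + h *: delta_mx i 0) - w y| <= c * `|h|) ->
  `|partial i w y| <= c.
Proof.
move=> /derivableP /is_derive_cvgP dw wc.
rewrite leNgt; apply/negP; rewrite -subr_gt0 => e0.
have /cvgrPdist_lt/(_ _ e0) nw := dw.
near (0 : R)^' => h.
have h0 : h != 0 by near: h; exact: nbhs_dnbhs_neq.
have h1 : `|h| <= 1.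
  by apply: ltW; near: h; apply: dnbhs0_lt.
have : `|partial i w y - h^-1 * (w (y + h *: delta_mx i 0) - w y)| <
  `|partial i w y| - c by near: h.
apply/negP; rewrite -leNgt.
apply: le_trans (lerB_dist _ _); rewrite lerD2l lerN2 normrM normfV.
by rewrite mulrC ler_pdivrMr ?normr_gt0// wc.
Unshelve. all: by end_near. Qed.

Lemma dot_delta (R : realType) (m : nat) (i : 'I_m) :
  dot (delta_mx i 0 : 'cV[R]_m) (delta_mx i 0) = 1.
Proof.
rewrite /dot (bigD1 i)//= !mxE !eqxx mulr1 big1 ?addr0// => j ji.
by rewrite !mxE (negbTE ji) mul0r.
Qed.

Section Constants.
Context {R : realType} (n m : nat).
Variables (sigma : 'cV[R]_n -> 'cV[R]_m -> 'M[R]_(n, m))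
  (b : 'cV[R]_m -> 'cV[R]_m) (tau : 'cV[R]_m -> 'M[R]_m).

Lemma nondegenerate_dot : uniformly_nondegenerate tau ->
  exists2 theta : R, 0 < theta & forall y xi,
    theta * dot xi xi <= dot ((tau y)^T *m xi) ((tau y)^T *m xi).
Proof.
move=> [theta t0 ht]; exists theta => // y xi.
have [->|xi0] := eqVneq xi 0.
  by rewrite -{1}(scale0r 0) dotZl mul0r mulr0 dot_ge0.
by have /ltW := ht y xi xi0; rewrite !enorm_sqr.
Qed.

Lemma lipschitz_frob2 : lipschitz tau ->
  exists2 L2 : R, 0 <= L2 &
    forall x y, frob2 (tau x - tau y) <= L2 * dot (x - y) (x - y).
Proof.
move=> /lipschitzE[L L0 hL]; exists ((m * m)%:R * L ^+ 2) => [|x y].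
  by rewrite mulr_ge0// sqr_ge0.
apply: (le_trans (frob2_le_norm _)); rewrite -mulrA ler_wpM2l//.
apply: (@le_trans _ _ (L ^+ 2 * `|x - y| ^+ 2)).
  by rewrite -exprMn ler_pXn2r ?nnegrE ?mulr_ge0.
by rewrite ler_wpM2l ?sqr_ge0// norm_le_dot.
Qed.

Lemma lipschitz_dot : lipschitz b ->
  exists2 L2 : R, 0 <= L2 &
    forall x y, dot (b x - b y) (b x - b y) <= L2 * dot (x - y) (x - y).
Proof.
move=> /lipschitzE[L L0 hL]; exists (m%:R * L ^+ 2) => [|x y].
  by rewrite mulr_ge0// sqr_ge0.
apply: (le_trans (dot_le_norm _)); rewrite -mulrA ler_wpM2l//.
apply: (@le_trans _ _ (L ^+ 2 * `|x - y| ^+ 2)).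
  by rewrite -exprMn ler_pXn2r ?nnegrE ?mulr_ge0.
by rewrite ler_wpM2l ?sqr_ge0// norm_le_dot.
Qed.

Lemma dot_le_half (k : nat) (u v : 'cV[R]_k) :
  dot u v <= 2^-1 * (dot u u + dot v v).
Proof. by have := dotB_scale_ge0 1 u v; lra. Qed.

(** On the ball where dissipativity is not assumed, [dot y (b y)] is bounded by the
linear growth of [b], and the additive constant absorbs that bound. *)
Lemma dissipative_everywhere : lipschitz b -> condition_E b ->
  exists B C0 : R, [/\ 0 < B, 0 <= C0 &
    forall y, dot y (b y) <= C0 - B * dot y y].
Proof.
move=> /lipschitz_dot[L2 L20 hL] [B [R0 [B0 hB]]].
exists B, (2^-1 * R0 ^+ 2 + dot (b 0) (b 0) + L2 * R0 ^+ 2 + B * R0 ^+ 2).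
have p1 : 0 <= 2^-1 * R0 ^+ 2 by rewrite mulr_ge0 ?sqr_ge0.
have p2 : 0 <= L2 * R0 ^+ 2 by rewrite mulr_ge0 ?sqr_ge0.
have p3 : 0 <= B * R0 ^+ 2 by rewrite mulr_ge0 ?sqr_ge0 ?ltW.
have p4 := dot_ge0 (b 0).
split => // [|y]; first by rewrite !addr_ge0.
have [yR|yR] := ltP R0 (enorm y).
  have := hB y yR; rewrite enorm_sqr dotC mulNr => /le_trans; apply.
  by rewrite lerDr !addr_ge0.
have yy : dot y y <= R0 ^+ 2.
  rewrite -enorm_sqr ler_pXn2r ?nnegrE ?enorm_ge0//.
  exact: le_trans (enorm_ge0 y) yR.
have h1 := dot_le_half y (b y).
have h2 : dot (b y) (b y) <= 2 * (L2 * dot y y + dot (b 0) (b 0)).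
  have -> : b y = b y - b 0 + b 0 by rewrite subrK.
  apply: (le_trans (dotD_sqr_le _ _)); rewrite ler_pM2l// lerD2r.
  by have := hL y 0; rewrite subr0.
have h3 := ler_wpM2l L20 yy; have h4 := ler_wpM2l (ltW B0) yy.
apply: (le_trans h1).
move: h2 h3 h4 yy; clear.
move: (dot y y) (dot (b y) (b y)) (dot (b 0) (b 0)) => s t u.
lra.
Qed.

Lemma source_bounded (p : 'cV[R]_n) :
  bounded_fun (fun z : 'cV[R]_n * 'cV[R]_m => sigma z.1 z.2) ->
  exists2 M : R, 0 < M &
    forall x y, 0 <= enorm ((sigma x y)^T *m p) ^+ 2 <= M.
Proof.
move=> /bounded_funE[W W0 hW].
exists ((n * m)%:R * W ^+ 2 * dot p p + 1) => [|x y].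
  by rewrite ltr_wpDl// mulr_ge0 ?dot_ge0// mulr_ge0 ?sqr_ge0.
rewrite sqr_ge0 enorm_sqr /=; apply: (le_trans (dot_trmx_mul_le _ _)).
rewrite ler_wpDr// ler_wpM2r ?dot_ge0//.
apply: (le_trans (frob2_le_norm _)); rewrite ler_wpM2l//.
by rewrite ler_pXn2r ?nnegrE//; exact: (hW (x, y)).
Qed.

End Constants.

(** Each partial derivative is a limit of difference quotients with increments of
length at most 1, so only points [z] with [dot z z <= 2 k^2 + 2] enter the
two-point estimate. *)
Lemma enorm_grad_le (R : realType) (m : nat) (w : 'cV[R]_m -> R) (y : 'cV[R]_m)
    (K K' k : R) :
  C1 w -> 0 <= K -> 0 <= K' ->
  (forall x y, w x - w y <= K * enorm (x - y) * (K' + dot x x + dot y y)) ->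
  0 <= k -> enorm y <= k ->
  enorm (grad w y) <= Num.sqrt (m%:R * (K * (K' + 3 * k ^+ 2 + 2)) ^+ 2).
Proof.
move=> [_ w1] K0 K'0 wK k0 yk.
set c := K * _.
have c0 : 0 <= c by rewrite mulr_ge0// !addr_ge0// mulr_ge0// sqr_ge0.
rewrite ler_wsqrtr// -[m in m%:R]card_ord mulr_natl -sumr_const.
apply: ler_sum => i _; rewrite !mxE -expr2 -real_normK ?num_real//.
rewrite ler_pXn2r ?nnegrE//.
have [dw _] := w1 i.
apply: partial_bound => // h h1.
set e := delta_mx i 0; set z := y + h *: e.
have hh : enorm (h *: e) = `|h|.
  by rewrite /enorm dotZl dotZr dot_delta mulr1 -expr2 sqrtr_sqr.
have yy : dot y y <= k ^+ 2.
  by rewrite -enorm_sqr ler_pXn2r ?nnegrE ?enorm_ge0.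
have zz : dot z z <= 2 * k ^+ 2 + 2.
  apply: (le_trans (dotD_sqr_le _ _)).
  rewrite (_ : 2 * k ^+ 2 + 2 = 2 * (k ^+ 2 + 1)); last by ring.
  rewrite ler_pM2l// lerD// -enorm_sqr hh.
  by rewrite expr_le1.
have sum_le : K' + dot y y + dot z z <= K' + 3 * k ^+ 2 + 2.
  rewrite (_ : K' + 3 * k ^+ 2 + 2 = K' + k ^+ 2 + (2 * k ^+ 2 + 2)).
    by rewrite lerD// lerD2l.
  by ring.
have zy : z - y = h *: e by rewrite /z addrC addKr.
have yz : y - z = - (h *: e) by rewrite -zy opprB.
have bnd : K * `|h| * (K' + dot y y + dot z z) <= c * `|h|.
  by rewrite /c mulrAC ler_wpM2r// ler_wpM2l.
rewrite ler_norml lerNl opprB; apply/andP; split.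
  have := wK y z; rewrite yz.
  have -> : enorm (- (h *: e)) = `|h| by rewrite -hh /enorm dotNl dotNr opprK.
  by move=> /le_trans; apply.
have := wK z y; rewrite zy hh => /le_trans; apply.
by rewrite addrAC.
Qed.

Theorem lemma4p3 (R : realType) (n m : nat)
  (sigma : 'cV[R]_n -> 'cV[R]_m -> 'M[R]_(n, m))
  (b : 'cV[R]_m -> 'cV[R]_m) (tau : 'cV[R]_m -> 'M[R]_m)
  (Hcoef : standing_assumptions sigma b tau)
  (HE : condition_E b) (HS1 : condition_S1 sigma) :
  forall (k : nat) (p : 'cV[R]_n),
  exists2 C : R, 0 < C &
    forall (x : 'cV[R]_n) (delta : R) (w : 'cV[R]_m -> R),
      0 < delta -> bounded_solution sigma b tau delta x p w ->
      forall y : 'cV[R]_m, enorm y <= k%:R -> enorm (grad w y) <= C.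
Proof.
move=> k p.
case: Hcoef => [[sigma_bnd _] b_lip [tau_bnd tau_lip] /nondegenerate_dot].
move=> [theta theta0 tau_ell].
have [W W0 tauW] := bounded_funE tau_bnd.
have tau_frob y : frob2 (tau y) <= (m * m)%:R * W ^+ 2.
  apply: (le_trans (frob2_le_norm _)); rewrite ler_wpM2l//.
  by rewrite ler_pXn2r ?nnegrE.
have Lam0 : 0 <= (m * m)%:R * W ^+ 2 by rewrite mulr_ge0 ?sqr_ge0.
have [L2 L20 tau_L2] := lipschitz_frob2 tau_lip.
have [Lb Lb0 b_Lb] := lipschitz_dot b_lip.
have b_one_sided x y :
    dot (x - y) (b x - b y) <= 2^-1 * (1 + Lb) * dot (x - y) (x - y).
  apply: (le_trans (dot_le_half _ _)); rewrite -mulrA ler_pM2l ?invr_gt0//.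
  by rewrite mulrDl mul1r lerD2l.
have Lb'0 : 0 <= 2^-1 * (1 + Lb) by rewrite mulr_ge0 ?invr_ge0// addr_ge0.
have [B [C0 [B0 C00 b_diss]]] := dissipative_everywhere b_lip HE.
have [M M0 fM] := source_bounded p sigma_bnd.
have [K [K' [K0 K'0 bound]]] := two_point_bound theta0 Lam0 L20 Lb'0 B0 C00 M0
  tau_ell tau_frob tau_L2 b_one_sided b_diss.
exists (Num.sqrt (m%:R * (K * (K' + 3 * k%:R ^+ 2 + 2)) ^+ 2) + 1).
  by rewrite ltr_wpDl ?sqrtr_ge0.
move=> x delta w delta0 [w2 w_bnd w_eq] y yk.
have w_two_point := bound delta (fun y => enorm ((sigma x y)^T *m p) ^+ 2) w
  delta0 w2 w_bnd (fM x) w_eq.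
have w1 : C1 w by case: w2.
by rewrite ler_wpDr// (enorm_grad_le w1 K0 K'0 w_two_point).
Qed.
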